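(* Let $s\in(0,1]$, let $I\subseteq[0,\infty)$ be an interval with interior $I^{\circ}$, let $f:I\to\mathbb{R}$ be differentiable on $I^{\circ}$, let $a,b\in I^{\circ}$ with $a<b$, and suppose $f'\in L[a,b]$. Let $\theta,\lambda\in[0,1]$, let $q>1$ and let $p$ satisfy $\frac1p+\frac1q=1$. If $|f'|^q$ is $s$-convex on $[a,b]$, then $$\left|(1-\theta)\bigl(\lambda f(a)+(1-\lambda)f(b)\bigr)+\theta f\bigl((1-\lambda)a+\lambda b\bigr)-\frac{1}{b-a}\int_a^b f(x)\,dx\right|$$ $$\le (b-a)\left(\frac{\theta^{p+1}+(1-\theta)^{p+1}}{p+1}\right)^{\frac1p}\left[\lambda^2\left(\frac{|f'(a)|^q+|f'(C)|^q}{s+1}\right)^{\frac1q}+(1-\lambda)^2\left(\frac{|f'(b)|^q+|f'(C)|^q}{s+1}\right)^{\frac1q}\right],$$ where $C=(1-\lambda)a+\lambda b$.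
   Context: For fixed $s\in(0,1]$, a nonnegative function $g$ is $s$-convex (in the second sense) on $[a,b]\subseteq[0,\infty)$ if $g(tx+(1-t)y)\le t^s g(x)+(1-t)^s g(y)$ for all $x,y\in[a,b]$ and $t\in[0,1]$. $L[a,b]$ denotes the space of Lebesgue integrable functions on $[a,b]$. *)

(* Defs.v *)
From mathcomp Require Import all_boot all_order all_algebra.
From mathcomp Require Import all_classical all_reals all_analysis.
Set Implicit Arguments.
Unset Strict Implicit.
Unset Printing Implicit Defensive.
Import Order.TTheory GRing.Theory Num.Theory.
Import numFieldNormedType.Exports.
Local Open Scope ring_scope.
Local Open Scope classical_set_scope.

(* s-convexity in the second sense, meant for 0 < s <= 1 and A an interval
   contained in [0, +oo[; the powers t^s are real powers, with 0 `^ s = 0 as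
   soon as s != 0. Nonnegativity of g on A is part of the notion. *)
Definition s_convex (R : realType) (s : R) (A : set R) (g : R -> R) : Prop :=
  (forall x, A x -> 0 <= g x) /\
  (forall x y t, A x -> A y -> 0 <= t <= 1 ->
    g (t * x + (1 - t) * y) <= t `^ s * g x + (1 - t) `^ s * g y).

(* Main.v *)
Require Import Defs.
From mathcomp Require Import all_boot all_order all_algebra.
From mathcomp Require Import all_classical all_reals all_analysis.
From mathcomp Require Import ring lra.
Import Order.TTheory GRing.Theory Num.Theory.
Import numFieldNormedType.Exports.
Local Open Scope ring_scope.
Local Open Scope classical_set_scope.

(* With w(t) = tC + (1 - t)u and sg = 1 - theta, the map
     G(t) = (C - u) (t - sg) f(w(t)) - P(w(t)),
   where P is a primitive of f and u is a or b, has derivative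
   (C - u)^2 (t - sg) f'(w(t)), and the quantity to bound, multiplied by b - a,
   is the difference of the increments G(1) - G(0) for u = a and u = b.
   By Young's inequality and s-convexity, |G'| is at most the derivative of an
   explicit M whose increment over [0, 1] is the claimed bound, so the mean
   value theorem replaces the integration by parts and Hoelder's inequality:
   f' is never integrated. *)

Lemma mulr_powR {R : realType} (x r : R) : 0 <= x -> 0 < r ->
  x * x `^ r = x `^ (r + 1).
Proof. by move=> x0 r0; rewrite -[RHS]mulr_powRB1 ?addrK ?addr_gt0. Qed.

(* Unlike `y `^ (r + 1)`, this antiderivative is differentiable at 0 and on
   the negatives, so the M of the header is differentiable on all of [0, 1]. *)
Lemma is_derive_mulr_normr_powR {R : realType} (r x : R) : 0 < r ->
  is_derive x 1 (fun y : R => y * `|y| `^ r) ((r + 1) * `|x| `^ r).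
Proof.
move=> r0; have pos (z : R) : 0 < z ->
    is_derive z 1 (fun y : R => y * `|y| `^ r) ((r + 1) * `|z| `^ r).
  move=> z0; refine (@near_eq_is_derive _ R R (fun y : R => y `^ (r + 1)) _ _ _ _ _ _).
    near=> y; have y0 : 0 < y by near: y; exact: lt_nbhsr.
    by rewrite gtr0_norm// mulr_powR// ltW.
  by rewrite gtr0_norm//; have := is_derive1_powR (r + 1) z0; rewrite addrK.
have [x0|x0|->] := ltgtP x 0; last 1 first.
(* At 0 the difference quotient is [|h|]^ r[, which is below]e[as soon as]|h| < e [^ r^-1]. *)
- have lim0 : h^-1 *: ((h *: 1 + 0 : R) * `|h *: 1 + 0 : R| `^ r
      - 0 * `|0 : R| `^ r) @[h --> (0 : R)^'] --> (0 : R).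
    apply/cvgrPdist_lt => e e0; near=> h.
    have h0 : h != 0 by near: h; exact: nbhs_dnbhs_neq.
    rewrite mul0r subr0 addr0 scaler1 sub0r normrN /GRing.scale/= mulKf//.
    rewrite ger0_norm ?powR_ge0//.
    have -> : e = (e `^ r^-1) `^ r by rewrite -powRrM mulVf ?gt_eqF// powRr1// ltW.
    apply: gt0_ltr_powR => //; rewrite ?nnegrE ?powR_ge0//.
    by near: h; apply: dnbhs0_lt; rewrite powR_gt0.
  rewrite normr0 powR0 ?gt_eqF// mulr0; apply: DeriveDef.
    by apply/cvg_ex; exists 0; exact: lim0.
  by apply/cvg_lim => //; exact: lim0.
- have x'0 : 0 < - x by rewrite oppr_gt0.
  have D := is_deriveN (is_derive1_comp (pos _ x'0) (is_deriveN (is_derive_id x 1))).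
  (* The map is odd, so the negative case is [pos] at [- x] with two sign changes. *)
  have -> : (fun y : R => y * `|y| `^ r) =
      - ((fun y : R => y * `|y| `^ r) \o - (@id R)).
    by apply/funext => y; rewrite !fctE mulNr opprK normrN.
  by apply: (is_derive_eq D); rewrite normrN mulrN1 opprK.
- exact: pos.
Unshelve. all: by end_near. Qed.

(** [M + G] and [M - G] have nonnegative derivatives, so the mean value theorem makes both of their
    increments nonnegative. *)
Lemma ler_norm_increment {R : realType} (G M dG dM : R -> R) (a b : R) :
  a <= b ->
  (forall x : R, a <= x <= b -> is_derive x 1 G (dG x)) ->
  (forall x : R, a <= x <= b -> is_derive x 1 M (dM x)) ->
  (forall x : R, a <= x <= b -> `|dG x| <= dM x) ->
  `|G b - G a| <= M b - M a.
Proof.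
move=> ab GE ME le_dM.
have mono (F dF : R -> R) : (forall x : R, a <= x <= b -> is_derive x 1 F (dF x)) ->
    (forall x : R, a <= x <= b -> 0 <= dF x) -> 0 <= F b - F a.
  move=> FE dF0; have [||c + ->] := @MVT_segment R F dF a b ab.
  - by move=> x xab; apply: FE; have := subset_itv_oo_cc xab; rewrite in_itv.
  - apply: derivable_within_continuous => x; rewrite in_itv/= => xab.
    by have [] := FE _ xab.
  - by rewrite in_itv/= => cab; rewrite mulr_ge0 ?dF0// subr_ge0.
have H1 := mono _ _ (fun x xab => is_deriveD (ME x xab) (GE x xab)).
have H2 := mono _ _ (fun x xab => is_deriveB (ME x xab) (GE x xab)).
rewrite ler_norml; apply/andP; split.
- have /H1 : forall x : R, a <= x <= b -> 0 <= dM x + dG x.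
    by move=> x /le_dM; rewrite ler_norml => /andP[+ _]; lra.
  rewrite !fctE; lra.
- have /H2 : forall x : R, a <= x <= b -> 0 <= dM x - dG x.
    by move=> x /le_dM; rewrite ler_norml => /andP[_]; lra.
  rewrite !fctE; lra.
Qed.

(* When Y = 0 the factors Y^-1 are junk, harmless since then y = 0. *)
Lemma young_normalized {R : realType} (p q x y X Y : R) :
  0 < p -> 0 < q -> p^-1 + q^-1 = 1 -> 0 <= x -> 0 <= y ->
  0 < X -> 0 <= Y -> (Y = 0 -> y = 0) ->
  x * y <= X `^ p^-1 * Y `^ q^-1 * (x `^ p / X / p + y `^ q / Y / q).
Proof.
move=> p0 q0 pq x0 y0 X0; rewrite le_eqVlt => /predU1P[<- /(_ erefl)->|Y0 _].
  by rewrite (powR0 (x := q^-1)) ?gt_eqF ?invr_gt0// !mulr0 mul0r.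
(* Young's inequality is applied to [x / X]^ p^-1[and]y / Y [^ q^-1]; this is the normalization used
   in the proof of Hoelder's inequality. *)
have scale (r z Z : R) : 0 < r -> 0 <= z -> 0 < Z ->
    (z / Z `^ r^-1) `^ r = z `^ r / Z.
  move=> r0 z0 Z0; rewrite -powRN powRM ?powR_ge0// -powRrM mulNr mulVf ?gt_eqF//.
  by rewrite powR_inv1// ltW.
rewrite -ler_pdivrMl ?mulr_gt0 ?powR_gt0//.
rewrite -(scale p x X)// -(scale q y Y)//.
apply: le_trans (conjugate_powR _ _ p0 q0 pq); rewrite ?divr_ge0 ?powR_ge0//.
by rewrite invfM mulrACA [_^-1 * x]mulrC [_^-1 * y]mulrC.
Qed.

(** One half of the estimate: [v] will be [C] and [u] an endpoint. The factor [v - u] is signed, so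
    the same statement serves for [u = a] and [u = b]. *)
Lemma affine_trapezoid_bound {R : realType} (f df P : R -> R)
    (u v A B s p q theta : R) :
  let w (t : R) : R := t * v + (1 - t) * u in
  0 < s -> 0 < p -> 0 < q -> p^-1 + q^-1 = 1 -> 0 <= theta <= 1 ->
  0 <= A -> 0 <= B ->
  (forall t : R, 0 <= t <= 1 -> is_derive (w t) 1 f (df (w t))) ->
  (forall t : R, 0 <= t <= 1 -> is_derive (w t) 1 P (f (w t))) ->
  (forall t : R, 0 <= t <= 1 ->
    `|df (w t)| `^ q <= t `^ s * B + (1 - t) `^ s * A) ->
  `|(v - u) * ((1 - theta) * f u + theta * f v) - (P v - P u)| <=
  (v - u) ^+ 2 *
    (((theta `^ (p + 1) + (1 - theta) `^ (p + 1)) / (p + 1)) `^ p^-1 *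
     ((A + B) / (s + 1)) `^ q^-1).
Proof.
move=> w s0 p0 q0 pq /andP[th0 th1] A0 B0 fE PE dfle.
set X := (_ / (p + 1)); set Y := (_ / (s + 1)); set K := (X `^ _ * _).
have p1_gt0 : 0 < p + 1 by rewrite addr_gt0.
have s1_gt0 : 0 < s + 1 by rewrite addr_gt0.
have X0 : 0 < X.
  rewrite divr_gt0//; have [->|th] := eqVneq theta 0.
    by rewrite subr0 powR1 ltr_wpDl ?powR_ge0.
  by rewrite ltr_wpDr ?powR_ge0// powR_gt0// lt_neqAle eq_sym th.
have Y0 : 0 <= Y by rewrite divr_ge0 ?addr_ge0// ltW.
have K0 : 0 <= K by apply: mulr_ge0; exact: powR_ge0.
have wE (t : R) : is_derive t 1 w (v - u).
  have D := is_deriveD (is_deriveZ v (is_derive_id t 1))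
    (is_deriveZ u (is_deriveB (is_derive_cst (1 : R) t 1) (is_derive_id t 1))).
  have -> : w = v *: (@id R) + u *: (cst 1 - @id R).
    by apply/funext => y; rewrite /w !fctE /GRing.scale/= mulrC [u * _]mulrC.
  by apply: (is_derive_eq D); rewrite /GRing.scale/=; ring.
have shiftE (a b t : R) : is_derive t 1 (fun y : R => a * y + b) a.
  have D := is_deriveD (is_deriveZ a (is_derive_id t 1)) (is_derive_cst b t 1).
  by apply: (is_derive_eq D); rewrite /GRing.scale/=; ring.
pose phi (r y : R) : R := y * `|y| `^ r.
have phiE (r y : R) : 0 < r -> is_derive y 1 (phi r) ((r + 1) * `|y| `^ r).
  by move=> r0; apply: (is_derive_mulr_normr_powR r y r0).
pose sg := 1 - theta.
(* Y may be 0; naming its inverse makes the identities below independent of it. *)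
have [iY iYE] : {y | y = Y^-1} by exists Y^-1.
pose G (t : R) : R := (v - u) * (t - sg) * f (w t) - P (w t).
(* The factors [p + 1] and [s + 1] cancel those produced by differentiating [phi], so that [M] has
   as derivative [(v - u) ^+ 2] times the bound of [young_normalized]. The minus sign before [A]
   compensates the reflection [1 - t]. *)
pose c1 := (v - u) ^+ 2 * K / ((p + 1) * X * p).
pose c2 := (v - u) ^+ 2 * K * iY / ((s + 1) * q).
pose M (t : R) : R := c1 * phi p (t - sg) + c2 * (B * phi s t - A * phi s (1 - t)).
have GE (t : R) : 0 <= t <= 1 ->
    is_derive t 1 G ((v - u) ^+ 2 * (t - sg) * df (w t)).
  (* Integration by parts in differential form: the term [(v - u) * f (w t)] of the product rule is
     cancelled by the derivative of [P \o w]. *)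
  move=> t01; have D := is_deriveB
    (is_deriveM (shiftE (v - u) (- (v - u) * sg) t)
                (is_derive1_comp (fE t t01) (wE t)))
    (is_derive1_comp (PE t t01) (wE t)).
  have -> : G = (fun y => (v - u) * y + - (v - u) * sg) * (f \o w) - (P \o w).
    by apply/funext => y; rewrite !fctE /G; ring.
  by apply: (is_derive_eq D); rewrite /GRing.scale/=; ring.
have ME (t : R) : 0 <= t <= 1 -> is_derive t 1 M
    ((v - u) ^+ 2 * K * (`|t - sg| `^ p / X / p +
      (t `^ s * B + (1 - t) `^ s * A) * iY / q)).
  move=> /andP[t0 t1]; have D := is_deriveD
    (is_deriveZ c1 (is_derive1_comp (phiE p _ p0) (shiftE 1 (- sg) t)))
    (is_deriveZ c2 (is_deriveB (is_deriveZ B (phiE s t s0))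
      (is_deriveZ A (is_derive1_comp (phiE s _ s0) (shiftE (- 1) 1 t))))).
  have <- : c1 *: (phi p \o (fun y => 1 * y + - sg)) +
      c2 *: (B *: phi s - A *: (phi s \o (fun y => - 1 * y + 1))) = M.
    apply/funext => y.
    by rewrite !fctE /= mul1r mulN1r [- y + 1]addrC.
  apply: (is_derive_eq D); rewrite mul1r mulN1r [- t + 1]addrC.
  rewrite [`|t|]ger0_norm// [`|1 - t|]ger0_norm ?subr_ge0//.
  by rewrite /GRing.scale/= /c1 /c2; field; rewrite !gt_eqF.
have le_dM (t : R) : 0 <= t <= 1 -> `|(v - u) ^+ 2 * (t - sg) * df (w t)| <=
    (v - u) ^+ 2 * K * (`|t - sg| `^ p / X / p +
      (t `^ s * B + (1 - t) `^ s * A) * iY / q).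
  move=> t01; rewrite -[_ * df _]mulrA -[_ * K * _]mulrA normrM.
  rewrite [`|_ ^+ 2|]ger0_norm ?sqr_ge0//.
  apply: ler_wpM2l; rewrite ?sqr_ge0// normrM.
  (* If [Y = 0] then [A = B = 0], and the convexity bound forces [df (w t) = 0], as the degenerate
     case requires. *)
  apply: le_trans (young_normalized _ _ _ _ _ _ p0 q0 pq _ _ X0 Y0 _) _ => //.
    move=> /eqP; rewrite mulf_eq0 invr_eq0 (gt_eqF s1_gt0) orbF paddr_eq0//.
    move=> /andP[/eqP A00 /eqP B00]; apply: (@powR_eq0_eq0 R _ q); apply/eqP.
    by rewrite eq_le powR_ge0 (le_trans (dfle t t01))// A00 B00 !mulr0 addr0.
  rewrite -/K ler_wpM2l// lerD2l iYE.
  by rewrite ler_wpM2r ?invr_ge0 ?(ltW q0)// ler_wpM2r ?invr_ge0// dfle.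
have w0 : w 0 = u by rewrite /w; ring.
have w1 : w 1 = v by rewrite /w; ring.
have phi0 r : phi r 0 = 0 by rewrite /phi mul0r.
have phi1 r : phi r 1 = 1 by rewrite /phi normr1 powR1 mul1r.
have := ler_norm_increment G M _ _ 0 1 ler01 GE ME le_dM.
have -> : G 1 - G 0 = (v - u) * ((1 - theta) * f u + theta * f v) - (P v - P u).
  by rewrite /G w0 w1 /sg; ring.
move=> /le_trans; apply.
have -> : M 1 - M 0 = (v - u) ^+ 2 * K * (p^-1 + Y * iY / q).
  rewrite /M subr0 subrr !phi0 !phi1 {1 2}/phi /sg subKr sub0r normrN.
  rewrite !ger0_norm ?subr_ge0// mulNr !mulr_powR ?subr_ge0//.
  rewrite /Y /c1 /c2.
  (* Eliminating one power in favour of [X] lets [field] cancel [X] as an atom. *)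
  have -> : theta `^ (p + 1) = (p + 1) * X - (1 - theta) `^ (p + 1).
    by rewrite /X; field; rewrite gt_eqF.
  by field; rewrite !gt_eqF.
(* [Y * iY] is 1, or 0 when [Y = 0]; either way the last factor is at most [p^-1 + q^-1 = 1]. *)
apply: ler_piMr; first by rewrite mulr_ge0 ?sqr_ge0.
rewrite -pq lerD2l iYE.
rewrite -[leRHS]mul1r ler_wpM2r ?invr_ge0 ?(ltW q0)//.
by have [->|Yn0] := eqVneq Y 0; rewrite ?mul0r ?ler01// mulfV.
Qed.

Lemma interior_enlarge {R : realType} (A : set R) (x : R) : A° x ->
  exists2 e : R, 0 < e & A (x - e) /\ A (x + e).
Proof.
move=> /nbhs_ballP[d /= d0 dA]; exists (d / 2); first by rewrite divr_gt0.
by split; apply: dA; rewrite /ball/= ?opprB ?opprD ?addNKr ?subrKC ?normrN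
  gtr0_norm; lra.
Qed.

Lemma is_interval_interior {R : realType} (I : set R) :
  is_interval I -> is_interval I°.
Proof.
move=> II x y /interior_enlarge[d d0 [Ix _]] /interior_enlarge[e e0 [_ Iy]] z xzy.
have zI : z \in `]x - d, y + e[%R by rewrite in_itv/=; lra.
apply: filterS (near_in_itvoo zI) => t /=; rewrite in_itv/= => /andP[xt ty].
by apply: II Ix Iy _ _; rewrite !ltW.
Qed.

(** The primitive is the integral from a base point [l < a], with [f] continuous up to some [r > b]:
    this margin makes the derivatives at [a] and [b] two-sided. *)
Lemma primitive_on_interval {R : realType} (I : set R) (f : R -> R) (a b : R) :
  is_interval I -> (forall x, I° x -> {for x, continuous f}) ->
  I° a -> I° b -> a < b ->
  exists P : R -> R, (forall x : R, a <= x <= b -> is_derive x 1 P (f x)) /\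
    \int[@lebesgue_measure R]_(x in `[a, b]) f x = P b - P a.
Proof.
move=> /is_interval_interior II cf Ia Ib ab.
(* Enlarging inside the open set [I°] rather than [I] keeps [l] and [r] where [f] is continuous. *)
have IE : I°° = I° by apply/interior_id; exact: open_interior.
have [d d0 [Il _]] : exists2 d : R, 0 < d & I° (a - d) /\ I° (a + d).
  by apply: interior_enlarge; rewrite IE.
have [e e0 [_ Ir]] : exists2 e : R, 0 < e & I° (b - e) /\ I° (b + e).
  by apply: interior_enlarge; rewrite IE.
set l := a - d in Il; set r := b + e in Ir.
have intf (x y : R) : l <= x -> y <= r ->
    (@lebesgue_measure R).-integrable `[x, y] (EFin \o f).
  move=> lx yr; apply: continuous_compact_integrable; first exact: segment_compact.
  apply: continuous_in_subspaceT => z; rewrite inE/= in_itv/= => /andP[xz zy].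
  by apply: cf; apply: II Il Ir _ _; rewrite (le_trans lx)// (le_trans zy).
have la : l < a by rewrite /l; lra.
have br : b < r by rewrite /r; lra.
exists (fun x => \int[@lebesgue_measure R]_(t in `[l, x]) f t); split.
  move=> x /andP[ax xb]; have lx := lt_le_trans la ax; have xr := le_lt_trans xb br.
  have [||dP P'x] := @continuous_FTC1_closed R f l x r xr _ lx.
  - exact: intf.
  - by apply: cf; apply: II Il Ir _ _; rewrite !ltW.
  - by split; [exact: dP|rewrite -derive1E; exact: P'x].
rewrite Rintegral_itvB ?bnd_simp ?(ltW la) ?(ltW ab)//; last first.
  by apply: intf => //; exact: ltW.
rewrite Rintegral_itv_obnd_cbnd//; apply: integrableS (intf a b _ _) => //; last 2 first.
- exact: ltW.
- exact: ltW.
- by apply: subset_itvr; rewrite bnd_simp.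
Qed.

Theorem theorem3 (R : realType) (s : R) (hs : 0 < s <= 1)
  (I : set R) (hI : is_interval I) (hI0 : I `<=` `[0, +oo[)
  (f : R -> R) (hf : forall x, I° x -> derivable f x 1)
  (a b : R) (ha : I° a) (hb : I° b) (hab : a < b)
  (hf' : (@lebesgue_measure R).-integrable `[a, b] (EFin \o f^`()))
  (theta lambda : R) (htheta : 0 <= theta <= 1) (hlambda : 0 <= lambda <= 1)
  (p q : R) (hq : 1 < q) (hpq : p^-1 + q^-1 = 1)
  (hconv : s_convex s `[a, b] (fun x => `|f^`() x| `^ q)) :
  let C := (1 - lambda) * a + lambda * b in
  `| (1 - theta) * (lambda * f a + (1 - lambda) * f b)
     + theta * f ((1 - lambda) * a + lambda * b)
     - (b - a)^-1 * \int[@lebesgue_measure R]_(x in `[a, b]) f x |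
  <= (b - a) *
     ((theta `^ (p + 1) + (1 - theta) `^ (p + 1)) / (p + 1)) `^ (p^-1) *
     (lambda ^+ 2 *
        ((`|f^`() a| `^ q + `|f^`() C| `^ q) / (s + 1)) `^ (q^-1)
      + (1 - lambda) ^+ 2 *
        ((`|f^`() b| `^ q + `|f^`() C| `^ q) / (s + 1)) `^ (q^-1)).
Proof.
have /andP[l0 l1] := hlambda; have /andP[s0 s1] := hs.
lazy zeta; set C := (1 - lambda) * a + lambda * b.
have q0 : 0 < q := lt_trans ltr01 hq.
have p0 : 0 < p.
  by rewrite -invr_gt0 -(addrK q^-1 p^-1) hpq subr_gt0 invf_lt1.
have cf x : I° x -> {for x, continuous f}.
  by move=> /hf /derivable1_diffP; exact: differentiable_continuous.
have [P [PE PI]] := primitive_on_interval I f a b hI cf ha hb hab.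
have conv_ab (x y t : R) : a <= x <= b -> a <= y <= b -> 0 <= t <= 1 ->
    a <= t * x + (1 - t) * y <= b.
  move=> /andP[ax xb] /andP[ay yb] /andP[t0 t1]; have t1' : 0 <= 1 - t by lra.
  have cst z : z = t * z + (1 - t) * z by ring.
  by rewrite [X in X <= _]cst [X in _ && (_ <= X)]cst !lerD ?ler_wpM2l.
have C_ab : a <= C <= b.
  by rewrite /C addrC conv_ab ?lexx ?(ltW hab).
have [_ gconv] := hconv.
have half (u : R) : a <= u <= b ->
    `|(C - u) * ((1 - theta) * f u + theta * f C) - (P C - P u)| <=
    (C - u) ^+ 2 *
    (((theta `^ (p + 1) + (1 - theta) `^ (p + 1)) / (p + 1)) `^ p^-1 *
     ((`|f^`() u| `^ q + `|f^`() C| `^ q) / (s + 1)) `^ q^-1).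
  move=> u_ab.
  have wab (t : R) : 0 <= t <= 1 -> a <= t * C + (1 - t) * u <= b.
    exact: conv_ab.
  apply: (affine_trapezoid_bound f (f^`()) P u C _ _ s p q theta) => //; rewrite ?powR_ge0//.
  - move=> t t01; split; last by rewrite derive1E.
    by apply: hf; apply: is_interval_interior hI _ _ ha hb _ (wab _ t01).
  - by move=> t t01; apply: PE; exact: wab.
  - by move=> t t01; apply: gconv => //=; rewrite in_itv.
have /half : a <= a <= b by rewrite lexx ltW.
have /half : a <= b <= b by rewrite lexx ltW.
set Tb := (X in `|X|) => Hb; set Ta := (X in `|X|) => Ha.
have ba0 : 0 < b - a by rewrite subr_gt0.
(* Since [C - a = lambda * (b - a)] and [C - b = - (1 - lambda) * (b - a)], subtracting the halves
   restores the weights; [P C] cancels and [- (P b - P a)] remains. *)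
have -> : (1 - theta) * (lambda * f a + (1 - lambda) * f b)
    + theta * f C
    - (b - a)^-1 * \int[@lebesgue_measure R]_(x in `[a, b]) f x
    = (Ta - Tb) / (b - a).
  by rewrite PI /Ta /Tb /C; field; rewrite gt_eqF.
rewrite normrM normfV [`|b - a|]gtr0_norm// ler_pdivrMr//.
(* The same two relations, squared, produce the coefficients [lambda ^+ 2] and
   [(1 - lambda) ^+ 2]. *)
have E (X Ya Yb : R) :
    (b - a) * X * (lambda ^+ 2 * Ya + (1 - lambda) ^+ 2 * Yb) * (b - a) =
    (C - a) ^+ 2 * (X * Ya) + (C - b) ^+ 2 * (X * Yb).
  by rewrite /C; ring.
by rewrite E; apply: le_trans (ler_normB _ _) (lerD Ha Hb).
Qed.
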